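(* Let $\mathsf{X}=\{x^1,\dots,x^d\}$ be a finite set, let $\mathcal{U}\colon\mathsf{X}\to\mathbb{R}_+$ be a function, let $x^\circ\in\mathsf{X}$ be a fixed state, and let $P_0$ be an irreducible and aperiodic transition matrix on $\mathsf{X}$. Suppose that the transition matrix $P_0^{\triangledown}=P_0^{\dagger}P_0$ is irreducible, where $P_0^\dagger$ is the adjoint of $P_0$ in $L_2(\pi_0)$ and $\pi_0$ is the invariant pmf of $P_0$. Let $\{h_\zeta:\zeta\in\mathbb{R}\}$ and $\{P_\zeta:\zeta\in\mathbb{R}\}$ be the functions and transition matrices given by the System Perspective Design (SPD) solution without exogenous randomness (defined in the context), and for each $\zeta$ let $\pi_\zeta$ be the invariant pmf of $P_\zeta$ and $G^+_\zeta$ the delay-free transfer function of the linearized mean-field model at $\zeta$ (defined in the context). Then for every $\zeta\in\mathbb{R}$, \[ G^+_\zeta(e^{j\theta})+G^+_\zeta(e^{-j\theta})\ \ge\ \sigma_\zeta^2\qquad\text{for all }\theta\in\mathbb{R}, \] where $j=\sqrt{-1}$ and $\sigma_\zeta^2=\sum_{x}\pi_\zeta(x)\bigl(\mathcal{U}(x)-\pi_\zeta(\mathcal{U})\bigr)^2$ is the variance of $\mathcal{U}$ under $\pi_\zeta$.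
   Context: Conventions. A pmf $\pi$ is a row vector and a function $f\colon\mathsf{X}\to\mathbb{R}$ is a column vector; $\pi(f)=\sum_x\pi(x)f(x)$ and $Pf(x)=\sum_{x'}P(x,x')f(x')$. For an irreducible transition matrix $P$ on $\mathsf{X}$ with invariant pmf $\pi$ (so $\pi P=\pi$, $\pi(x)>0$ for all $x$), the adjoint of $P$ in $L_2(\pi)$ is the transition matrix \[ P^{\dagger}(x,x')=\frac{\pi(x')}{\pi(x)}P(x',x), \] and $P^{\triangledown}=P^{\dagger}P$, i.e. $P^{\triangledown}(x,x')=\sum_{z}P^{\dagger}(x,z)P(z,x')$. Let $Z^{\triangledown}=[I-P^{\triangledown}+1\otimes\pi]^{-1}$, where $1\otimes\pi$ is the matrix each of whose rows equals $\pi$. SPD solution without exogenous randomness. For an irreducible transition matrix $P$ on $\mathsf{X}$ with invariant pmf $\pi$ for which the inverse $Z^{\triangledown}=[I-P^{\triangledown}+1\otimes\pi]^{-1}$ exists, define the function $H^\circ=\mathcal{H}^\circ(P)\colon\mathsf{X}\to\mathbb{R}$ by \[ H^\circ(x)=\sum_{x'}\bigl[Z^{\triangledown}(x,x')-Z^{\triangledown}(x^\circ,x')\bigr]\mathcal{U}(x'),\qquad x\in\mathsf{X}, \] and $\mathcal{H}(P)\colon\mathsf{X}\times\mathsf{X}\to\mathbb{R}$ by $\mathcal{H}(P)(x,x')=H^\circ(x')$. The families $\{h_\zeta\}$, $\{P_\zeta\}$ solve the ordinary differential equation \[ \frac{d}{d\zeta}h_\zeta=\mathcal{H}(P_\zeta),\qquad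 \zeta\in\mathbb{R},\qquad h_0\equiv0, \] where $h_\zeta\colon\mathsf{X}\times\mathsf{X}\to\mathbb{R}$ is continuously differentiable in $\zeta$ and $P_\zeta$ is determined by $h_\zeta$ through \[ P_\zeta(x,x')=P_0(x,x')\exp\bigl(h_\zeta(x,x')-\Lambda_{h_\zeta}(x)\bigr),\qquad \Lambda_{h_\zeta}(x)=\log\Bigl(\sum_{x'}P_0(x,x')\exp(h_\zeta(x,x'))\Bigr). \] Each $P_\zeta$ is irreducible and aperiodic. Linearized mean-field model. The mean-field model is $\mu_{t+1}=\mu_tP_{\zeta_t}$ with output $y_t=\sum_x\mu_t(x)\mathcal{U}(x)$. Its linearization at the constant input value $\zeta$ (about the equilibrium $\pi_\zeta$) is the linear state-space model $(A,B,C)$ with $A=P_\zeta^{T}$ (transpose), $C$ the row vector with $C_i=\mathcal{U}(x^i)-\pi_\zeta(\mathcal{U})$, and $B$ the column vector with \[ B_i=\sum_x\pi_\zeta(x)\,\frac{d}{d\zeta}P_\zeta(x,x^i),\qquad 1\le i\le d. \] The delay-free transfer function is \[ G^+_\zeta(z)=zC[Iz-A]^{-1}B=\sum_{k=0}^\infty CA^kB\,z^{-k}, \] understood through the series on the unit circle $|z|=1$. *)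

(* Defs.v *)
From HB Require Import structures.
From mathcomp Require Import all_boot all_order all_algebra.
From mathcomp Require Import complex.
From mathcomp Require Import all_classical all_reals all_analysis.

Set Implicit Arguments.
Unset Strict Implicit.
Unset Printing Implicit Defensive.

Import Order.TTheory GRing.Theory Num.Theory.
Import numFieldNormedType.Exports.

Local Open Scope classical_set_scope.
Local Open Scope complex_scope.
Local Open Scope ring_scope.

(* The state space X = {x^1, ..., x^d} is represented by 'I_d. *)

Section MarkovChains.
Context {R : realType} {d : nat}.
Implicit Types (P : 'M[R]_d) (p : 'rV[R]_d) (f : 'I_d -> R).

Definition stochastic P : Prop :=
  (forall x y, 0 <= P x y) /\ (forall x, \sum_y P x y = 1).

Definition irreducible P : Prop :=
  forall x y, exists n : nat, 0 < (P ^+ n) x y.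

(* The gcd of the return times to x is 1: every common divisor is 1. *)
Definition aperiodic P : Prop :=
  forall x (k : nat),
    (forall n : nat, (0 < n)%N -> 0 < (P ^+ n) x x -> (k %| n)%N) -> k = 1%N.

Definition is_invariant_pmf P p : Prop :=
  [/\ forall x, 0 <= p 0 x, \sum_x p 0 x = 1 & p *m P = p].

(* The default value 0 is irrelevant for a stochastic P, which always has an
   invariant pmf; it is unique when P is moreover irreducible. *)
Definition invariant_pmf P : 'rV[R]_d := xget 0 (is_invariant_pmf P).

Definition pmf_mean p f : R := \sum_x p 0 x * f x.

Definition pmf_variance p f : R :=
  \sum_x p 0 x * (f x - pmf_mean p f) ^+ 2.

Definition adjoint P : 'M[R]_d :=
  \matrix_(x, x') (invariant_pmf P 0 x' / invariant_pmf P 0 x * P x' x).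

Definition nabla P : 'M[R]_d := adjoint P *m P.

(* invmx is the genuine inverse only when the matrix is in unitmx, which is
   the case as soon as P is stochastic and P and nabla P are irreducible. *)
Definition Znabla P : 'M[R]_d :=
  invmx (1%:M - nabla P + (const_mx 1 : 'cV[R]_d) *m invariant_pmf P).

End MarkovChains.

Section SPD.
Context {R : realType} {d : nat}.
Variables (P0 : 'M[R]_d) (U : 'I_d -> R) (x0 : 'I_d).

Definition Hcirc (P : 'M[R]_d) (x : 'I_d) : R :=
  \sum_x' (Znabla P x x' - Znabla P x0 x') * U x'.

Definition calH (P : 'M[R]_d) : 'M[R]_d := \matrix_(x, x') Hcirc P x'.

Definition log_mgf (h : 'M[R]_d) (x : 'I_d) : R :=
  ln (\sum_x' P0 x x' * expR (h x x')).

Definition tilt (h : 'M[R]_d) : 'M[R]_d :=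
  \matrix_(x, x') (P0 x x' * expR (h x x' - log_mgf h x)).

(* Derivatives of matrix-valued functions of zeta are taken entrywise. *)
Definition spd_solution (h P : R -> 'M[R]_d) : Prop :=
  [/\ h 0 = 0,
      forall x x' zeta, derivable (fun s => h s x x' : R) zeta 1,
      forall x x', continuous (derive1 (fun s => h s x x' : R)),
      forall zeta x x',
        derive1 (fun s => h s x x' : R) zeta = calH (P zeta) x x'
    & forall zeta, P zeta = tilt (h zeta)].

End SPD.

Section LinearizedMeanField.
Context {R : realType} {d : nat}.
Variables (U : 'I_d -> R) (P : R -> 'M[R]_d) (zeta : R).

Definition lin_A : 'M[R]_d := (P zeta)^T.

Definition lin_B : 'cV[R]_d :=
  \col_i \sum_x invariant_pmf (P zeta) 0 x
                * derive1 (fun s => P s x i : R) zeta.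

Definition lin_C : 'rV[R]_d :=
  \row_i (U i - pmf_mean (invariant_pmf (P zeta)) U).

(* The regular algebra R[i]^o carries the usual topology of the complex
   numbers R[i]. *)
Definition transfer_term (z : R[i]) (k : nat) : R[i]^o :=
  ((lin_C *m lin_A ^+ k *m lin_B) 0 0)%:C * z ^- k.

Definition transfer_cvg (z : R[i]) : Prop := cvgn (series (transfer_term z)).

Definition transfer (z : R[i]) : R[i] := limn (series (transfer_term z)).

End LinearizedMeanField.

Definition expi {R : realType} (theta : R) : R[i] := cos theta +i* sin theta.

(* Main.v *)
(* Write [f = U - pi(U)], [<.,.>] for the inner product of L2(pi) and
   [r_k = <f, P^k f>]. The SPD equation makes [dP/dzeta (x, x')] equal to
   [P(x, x') (H x' - P H x)], so [B = pi (I - P^nabla) H]; since [H] is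
   [Z^nabla U] up to a constant, [H] solves Poisson's equation for [P^nabla] and
   [B = pi f]. Hence [C A^k B = r_k], and [G^+(z) + G^+(z^-1)] is [r_0] plus the
   power spectral density of [U] along the chain.

   Irreducibility of [P^nabla] depends only on the support of [P], which is that
   of [P0], and gives a Poincare inequality for the energy [|g|^2 - |P g|^2];
   so [P] is a strict contraction on mean-zero functions and [r_k] decays
   geometrically. For [g_n = sum_(k < n) z^-k P^k f] with [|z| = 1] one has
   [2 Re <f, g_(n+1)> - |f|^2 = |g_(n+1)|^2 - |P g_n|^2 >= |g_(n+1)|^2 - |g_n|^2],
   and a convergent sequence that dominates the increments of a nonnegative one
   has a nonnegative limit. *)

Require Import Defs.
From mathcomp Require Import all_boot all_order all_algebra.
From mathcomp Require Import complex.
From mathcomp Require Import all_classical all_reals all_analysis.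
From mathcomp Require Import ring lra.

Set Implicit Arguments.
Unset Strict Implicit.
Unset Printing Implicit Defensive.

Import Order.TTheory GRing.Theory Num.Theory.
Import numFieldNormedType.Exports.
Local Open Scope classical_set_scope.
Local Open Scope complex_scope.
Local Open Scope ring_scope.

(** * Supports of nonnegative matrices and the invariant pmf *)

Section SupportAndInvariance.
Context {R : realType} {d : nat}.
Implicit Types (P Q : 'M[R]_d) (p : 'rV[R]_d).

Lemma exp_mx_ge0 P n x y : (forall x y, 0 <= P x y) -> 0 <= (P ^+ n) x y.
Proof.
move=> P0; elim: n x y => [|n IHn] x y.
  by rewrite expr0 mxE; case: eqP.
by rewrite exprS -mulmxE mxE sumr_ge0 // => z _; rewrite mulr_ge0.
Qed.

Lemma exp_mxS_gt0 P n x y : (forall x y, 0 <= P x y) ->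
  0 < (P ^+ n.+1) x y -> exists2 z, 0 < P x z & 0 < (P ^+ n) z y.
Proof.
move=> P0; rewrite exprS -mulmxE mxE => sum_gt0.
have term_ge0 z : 0 <= P x z * (P ^+ n) z y by rewrite mulr_ge0 ?exp_mx_ge0.
have [z /andP[Pxz Pzy]|allN] := pickP (fun z => (0 < P x z) && (0 < (P ^+ n) z y)).
  by exists z.
move: sum_gt0; rewrite big1 ?ltxx // => z _; apply/eqP; rewrite mulf_eq0.
by move: (allN z); rewrite !lt0r P0 exp_mx_ge0 // !andbT => /negbT; rewrite negb_and !negbK.
Qed.

(** A positive entry of [P ^+ n] is a path of length [n] in the support of [P], and a larger support
    keeps that path. *)
Lemma exp_mx_support P Q n x y : (forall x y, 0 <= P x y) ->
    (forall x y, 0 <= Q x y) -> (forall x y, 0 < P x y -> 0 < Q x y) ->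
  0 < (P ^+ n) x y -> 0 < (Q ^+ n) x y.
Proof.
move=> P0 Q0 PQ; elim: n x y => [|n IHn] x y; first by rewrite !expr0.
case/exp_mxS_gt0 => // z /PQ Qxz /IHn Qzy.
rewrite exprS -mulmxE mxE (bigD1 z) //= ltr_pwDl ?mulr_gt0 // sumr_ge0 // => t _.
by rewrite mulr_ge0 ?exp_mx_ge0.
Qed.

Lemma irreducible_support P Q : (forall x y, 0 <= P x y) ->
    (forall x y, 0 <= Q x y) -> (forall x y, 0 < P x y -> 0 < Q x y) ->
  irreducible P -> irreducible Q.
Proof.
move=> P0 Q0 PQ irrP x y; have [n Pn] := irrP x y.
by exists n; apply: exp_mx_support Pn.
Qed.

Lemma stochastic_mul1 P : stochastic P -> P *m const_mx 1 = const_mx 1 :> 'cV_d.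
Proof.
case=> _ P1; apply/colP => x; rewrite !mxE -[RHS](P1 x).
by apply: eq_bigr => y _; rewrite mxE mulr1.
Qed.

(* The absolute value of a left eigenvector for the eigenvalue 1 is
   subinvariant, hence invariant because [P] preserves total mass. *)
Lemma invariant_pmf_exists P (x0 : 'I_d) : stochastic P ->
  exists p, is_invariant_pmf P p.
Proof.
move=> stP; have [P0 P1] := stP.
(* [P - 1] kills the constants, so it is singular and has a nonzero left kernel vector. *)
have [v v0 vP] : exists2 v : 'rV_d, v != 0 & v *m P = v.
  have : ~~ row_free (P - 1%:M).
    rewrite row_free_unit; apply/negP => unitP.
    have /colP/(_ x0) : const_mx 1 = 0 :> 'cV[R]_d.
      rewrite -[LHS](mulKmx unitP) mulmxBl stochastic_mul1 // mul1mx subrr.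
      exact: mulmx0.
    by rewrite !mxE => /eqP; rewrite oner_eq0.
  rewrite -kermx_eq0 => /rowV0Pn[v /sub_kermxP vP v0]; exists v => //.
  by apply/eqP; rewrite -subr_eq0 -[X in _ - X]mulmx1 -mulmxBr vP.
pose q : 'rV_d := \row_x `|v 0 x|.
have q_sub x : q 0 x <= (q *m P) 0 x.
  rewrite !mxE -{1}vP mxE (le_trans (ler_norm_sum _ _ _)) // ler_sum // => y _.
  by rewrite mxE normrM (ger0_norm (P0 _ _)).
have qP : q *m P = q.
  apply/rowP => x; apply/eqP; rewrite -subr_eq0; apply/eqP.
  apply: (psumr_eq0P (P := predT) (F := fun x => (q *m P) 0 x - q 0 x)) => //.
    by move=> y _; rewrite subr_ge0.
  rewrite sumrB; apply/eqP; rewrite subr_eq0; apply/eqP.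
  under eq_bigr do rewrite mxE.
  rewrite exchange_big; apply: eq_bigr => y _.
  by rewrite -mulr_sumr P1 mulr1.
have q0 x : 0 <= q 0 x by rewrite mxE.
pose s := \sum_x q 0 x.
have s0 : 0 < s.
  rewrite lt_neqAle sumr_ge0 // andbT eq_sym; apply: contra v0 => /eqP sq.
  apply/eqP/rowP => x; rewrite [RHS]mxE.
  by have := psumr_eq0P (fun y _ => q0 y) sq (i := x) isT; rewrite mxE => /normr0P/eqP.
exists (s^-1 *: q); split=> [x||].
- by rewrite mxE mulr_ge0 // invr_ge0 ltW.
- under eq_bigr do rewrite mxE.
  by rewrite -mulr_sumr mulVf ?gt_eqF.
- by rewrite -scalemxAl qP.
Qed.

Lemma invariant_pmfP P (x0 : 'I_d) : stochastic P ->
  is_invariant_pmf P (invariant_pmf P).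
Proof. by move=> stP; apply: xgetPex; apply: invariant_pmf_exists. Qed.

(** Some state [y] carries mass, a power of [P] moves part of it to [x], and [p] is invariant under
    that power. *)
Lemma invariant_pmf_gt0 P p x : stochastic P -> irreducible P ->
  is_invariant_pmf P p -> 0 < p 0 x.
Proof.
move=> [P0 P1] irrP [p0 p1 pP].
have pPn n : p *m P ^+ n = p.
  elim: n => [|n IHn]; first by rewrite expr0 mulmx1.
  by rewrite exprS -mulmxE mulmxA pP.
have [y py|allN] := pickP (fun y => 0 < p 0 y); last first.
  move: p1; rewrite big1 => [/eqP|y _]; first by rewrite eq_sym oner_eq0.
  by apply/eqP; move: (allN y); rewrite lt0r p0 andbT => /negbFE.
have [n Pn] := irrP y x.
rewrite -(pPn n) mxE (bigD1 y) //= ltr_pwDl ?mulr_gt0 // sumr_ge0 // => z _.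
by rewrite mulr_ge0 ?exp_mx_ge0.
Qed.

End SupportAndInvariance.

(** * Energy of a chain and contraction on mean-zero functions *)

Section SpectralGap.
Context {R : realType} {d : nat}.
Implicit Types (P : 'M[R]_d) (p : 'rV[R]_d) (f g : 'cV[R]_d).

Definition dot p f g : R := \sum_x p 0 x * (f x 0 * g x 0).

Lemma dot_ge0 p f : (forall x, 0 <= p 0 x) -> 0 <= dot p f f.
Proof. by move=> p0; apply: sumr_ge0 => x _; rewrite mulr_ge0 // -expr2 sqr_ge0. Qed.

Lemma dot_eq0 p f : (forall x, 0 < p 0 x) -> dot p f f = 0 -> f = 0.
Proof.
move=> p0 f0; apply/colP => x; rewrite [RHS]mxE.
have /(_ x isT)/eqP := psumr_eq0P (fun y _ => mulr_ge0 (ltW (p0 y)) (sqr_ge0 (f y 0))) f0.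
by rewrite mulf_eq0 gt_eqF //= mulf_eq0 orbb => /eqP.
Qed.

Lemma dot_adjoint P f g : (forall x, invariant_pmf P 0 x != 0) ->
  dot (invariant_pmf P) (P *m f) g = dot (invariant_pmf P) f (adjoint P *m g).
Proof.
move=> p0; rewrite /dot.
under eq_bigr do rewrite mxE mulr_suml mulr_sumr.
rewrite exchange_big /=; apply: eq_bigr => x _.
rewrite mxE !mulr_sumr; apply: eq_bigr => y _.
by rewrite !mxE; field; rewrite p0.
Qed.

(** Law of total variance: by invariance the left side is the mean conditional variance of [f] after
    one step. *)
Lemma dot_energy P p f : stochastic P -> p *m P = p ->
  dot p f f - dot p (P *m f) (P *m f) =
  \sum_z p 0 z * \sum_y P z y * (f y 0 - (P *m f) z 0) ^+ 2.
Proof.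
move=> [_ P1] pP.
have -> : dot p f f = \sum_z p 0 z * \sum_y P z y * (f y 0) ^+ 2.
  rewrite /dot -{1}pP.
  under eq_bigr do rewrite mxE mulr_suml.
  rewrite exchange_big /=; apply: eq_bigr => z _; rewrite mulr_sumr.
  by apply: eq_bigr => y _; ring.
rewrite -sumrB; apply: eq_bigr => z _; rewrite -mulrBr; congr (_ * _).
set m := (P *m f) z 0.
have -> : \sum_y P z y * (f y 0 - m) ^+ 2 =
  \sum_y (P z y * f y 0 ^+ 2 - 2 * m * (P z y * f y 0) + m ^+ 2 * P z y).
  by apply: eq_bigr => y _; ring.
rewrite big_split sumrB /= -!mulr_sumr P1.
have -> : \sum_y P z y * f y 0 = m by rewrite /m mxE.
ring.
Qed.

(** [nabla P] steps back along an edge of [P], then forward along one, so only the support of [P]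
    matters. *)
Lemma nabla_gt0P P x y : (forall x, 0 < invariant_pmf P 0 x) ->
    (forall x y, 0 <= P x y) ->
  0 < nabla P x y <-> exists z, 0 < P z x /\ 0 < P z y.
Proof.
move=> p0 P0; rewrite mxE.
have t0 z : 0 <= adjoint P x z * P z y.
  by rewrite mxE !mulr_ge0 // ?invr_ge0 ltW.
split=> [sum_gt0|[z [Pzx Pzy]]]; last first.
  rewrite (bigD1 z) //= ltr_pwDl ?sumr_ge0 //.
  by rewrite mxE !mulr_gt0 ?invr_gt0.
have [z /andP[Pzx Pzy]|allN] := pickP (fun z => (0 < P z x) && (0 < P z y)).
  by exists z.
move: sum_gt0; rewrite big1 ?ltxx // => z _; apply/eqP.
rewrite mxE !mulf_eq0; move: (allN z); rewrite !lt0r !P0 !andbT => /negbT.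
by rewrite negb_and !negbK => /orP[] ->; rewrite ?orbT.
Qed.

Lemma nabla_ge0 P x y : (forall x, 0 <= invariant_pmf P 0 x) ->
  (forall x y, 0 <= P x y) -> 0 <= nabla P x y.
Proof.
move=> p0 P0; rewrite mxE sumr_ge0 // => z _.
by rewrite mxE !mulr_ge0 // invr_ge0.
Qed.

(* Two states at positive [nabla P]-probability have a common [P]-predecessor,
   so chaining along a [nabla P]-path bounds every oscillation by the energy. *)
Lemma oscillation_energy P x y : stochastic P ->
    (forall x, 0 < invariant_pmf P 0 x) ->
    invariant_pmf P *m P = invariant_pmf P -> irreducible (nabla P) ->
  exists C : R, 0 <= C /\ forall f, (f x 0 - f y 0) ^+ 2 <=
    C * (dot (invariant_pmf P) f f - dot (invariant_pmf P) (P *m f) (P *m f)).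
Proof.
set p := invariant_pmf P => stP p0 pP irrQ; have [P0 P1] := stP.
have Q0 u v : 0 <= nabla P u v by apply: nabla_ge0 => // t; exact: ltW.
have [n] := irrQ x y; elim: n x => [|n IHn] x.
  rewrite expr0 mxE; case: eqP => [->|]; last by rewrite ltxx.
  by exists 0; split=> // f; rewrite subrr mul0r expr0n.
case/exp_mxS_gt0 => // u /(nabla_gt0P _ _ p0 P0)[z [Pzx Pzu]] /IHn[C [C0 Cuy]].
(* Weighted by [p 0 z * P z v], the left side is a single term of the nonnegative sum in
   [dot_energy]. *)
have step v f : 0 < P z v -> (f v 0 - (P *m f) z 0) ^+ 2 <=
    (p 0 z * P z v)^-1 * (dot p f f - dot p (P *m f) (P *m f)).
  move=> Pzv; rewrite dot_energy // mulrC ler_pdivlMr ?mulr_gt0 //.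
  rewrite (bigD1 z) //= (bigD1 v) //= mulrDr -addrA mulrC -mulrA lerDl.
  rewrite addr_ge0 // ?mulr_ge0 ?(ltW (p0 _)) //.
    by rewrite sumr_ge0 // => w _; rewrite mulr_ge0 ?sqr_ge0.
  rewrite sumr_ge0 // => w _; rewrite mulr_ge0 ?(ltW (p0 _)) // sumr_ge0 // => t _.
  by rewrite mulr_ge0 ?sqr_ge0.
(* The difference is split at the conditional mean [m] at [z] and at [u]; the factor 3 comes from
   [sq3]. *)
exists (3 * ((p 0 z * P z x)^-1 + (p 0 z * P z u)^-1 + C)); split.
  by rewrite mulr_ge0 // !addr_ge0 // invr_ge0 ltW // mulr_gt0.
move=> f; have := step x f Pzx; have := step u f Pzu; have := Cuy f.
set E := dot _ _ _ - _; set m := (P *m f) z 0 => h1 h2 h3.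
have sq3 (a b c : R) : (a + b + c) ^+ 2 <= 3 * (a ^+ 2 + b ^+ 2 + c ^+ 2).
  rewrite -subr_ge0; have -> : 3 * (a ^+ 2 + b ^+ 2 + c ^+ 2) - (a + b + c) ^+ 2 =
    (a - b) ^+ 2 + (b - c) ^+ 2 + (a - c) ^+ 2 by ring.
  by rewrite !addr_ge0 ?sqr_ge0.
have -> : f x 0 - f y 0 = (f x 0 - m) + (m - f u 0) + (f u 0 - f y 0) by ring.
apply: le_trans (sq3 _ _ _) _; rewrite -mulrA ler_pM2l // !mulrDl.
by rewrite !lerD // -sqrrN opprB.
Qed.

(** Averaged over independent pairs of states, the squared oscillations give twice the variance;
    hence [dot p f f <= K * E], which is the claim with [rho = 1 - K^-1]. *)
Lemma nabla_contraction P : stochastic P ->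
    (forall x, 0 < invariant_pmf P 0 x) -> is_invariant_pmf P (invariant_pmf P) ->
    irreducible (nabla P) ->
  exists2 rho : R, 0 <= rho < 1 & forall f, invariant_pmf P *m f = 0 ->
    dot (invariant_pmf P) (P *m f) (P *m f) <= rho * dot (invariant_pmf P) f f.
Proof.
set p := invariant_pmf P => stP p0 [_ p1 pP] irrQ; have [P0 _] := stP.
have /choice[C CP] : forall xy : 'I_d * 'I_d, exists C : R, 0 <= C /\
    forall f, (f xy.1 0 - f xy.2 0) ^+ 2 <=
      C * (dot p f f - dot p (P *m f) (P *m f)).
  by move=> [x y]; exact: oscillation_energy.
(* The summand 1 ensures [1 <= K], so that [1 - K^-1] lies in [[0, 1)]. *)
pose K := 1 + \sum_x \sum_y p 0 x * p 0 y * C (x, y).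
have K1 : 1 <= K.
  rewrite lerDl; apply: sumr_ge0 => x _; apply: sumr_ge0 => y _.
  by rewrite !mulr_ge0 ?(ltW (p0 _)) //; case: (CP (x, y)).
have K0 : 0 < K by apply: lt_le_trans K1.
exists (1 - K^-1).
  by rewrite subr_ge0 invf_le1 // K1 gtrBl invr_gt0.
move=> f pf; set E := dot p f f - dot p (P *m f) (P *m f).
have E0 : 0 <= E.
  rewrite /E dot_energy // sumr_ge0 // => z _; rewrite mulr_ge0 ?(ltW (p0 _)) //.
  by rewrite sumr_ge0 // => y _; rewrite mulr_ge0 ?sqr_ge0.
have pf0 : \sum_x p 0 x * f x 0 = 0 by have /matrixP/(_ 0 0) := pf; rewrite !mxE.
(* Once the square is expanded, the cross term contains the mean of [f], which is zero. *)
have ident : \sum_x \sum_y p 0 x * p 0 y * (f x 0 - f y 0) ^+ 2 = 2 * dot p f f.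
  have -> : \sum_x \sum_y p 0 x * p 0 y * (f x 0 - f y 0) ^+ 2 =
     \sum_x (p 0 x * (f x 0 * f x 0) - 2 * p 0 x * f x 0 * (\sum_y p 0 y * f y 0)
            + p 0 x * dot p f f).
    apply: eq_bigr => x _.
    rewrite -[X in X - _]mulr1 -[X in _ * X - _]p1 /dot !mulr_sumr -sumrB.
    by rewrite -big_split; apply: eq_bigr => y _ /=; ring.
  rewrite pf0; under eq_bigr do rewrite mulr0 subr0.
  by rewrite big_split /= -mulr_suml p1 -/(dot p f f); ring.
have poincare : dot p f f <= K * E.
  have : 2 * dot p f f <= (K - 1) * E.
    rewrite -ident /K addrC addKr mulr_suml; apply: ler_sum => x _.
    rewrite mulr_suml; apply: ler_sum => y _.
    rewrite -[leRHS]mulrA ler_pM2l ?mulr_gt0 //.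
    by have [_] := CP (x, y); exact.
  have : 0 <= dot p f f by apply: dot_ge0 => x; exact: ltW.
  nra.
rewrite mulrBl mul1r lerBrDr -lerBrDl -/E mulrC ler_pdivrMr //.
by rewrite mulrC.
Qed.

End SpectralGap.

(** * Geometric decay of autocovariances and nonnegativity of the power spectrum *)

Section PowerSpectrum.
Context {R : realType} {d : nat}.
Implicit Types (P : 'M[R]_d) (p : 'rV[R]_d) (f g : 'cV[R]_d).

(** Cauchy-Schwarz in AM-GM form: the square of [a f - e g] has nonnegative mean, and the signs
    [e = 1] and [e = -1] together give the absolute value. *)
Lemma dot_le_weighted p f g (a : R) : (forall x, 0 <= p 0 x) -> 0 < a ->
  2 * `|dot p f g| <= a * dot p f f + a^-1 * dot p g g.
Proof.
move=> p0 a0; set W := _ + _.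
have key (e : R) : e ^+ 2 = 1 -> 0 <= W - 2 * (e * dot p f g).
  move=> e1; have -> : W - 2 * (e * dot p f g) =
      \sum_x p 0 x * (a^-1 * (a * f x 0 - e * g x 0) ^+ 2).
    rewrite /W /dot !mulr_sumr -big_split -sumrB; apply: eq_bigr => x _ /=.
    rewrite sqrrB exprMn [(e * _) ^+ 2]exprMn e1; field.
    by rewrite gt_eqF.
  by apply: sumr_ge0 => x _; rewrite mulr_ge0 // mulr_ge0 ?sqr_ge0 // invr_ge0 ltW.
have := key 1 (expr1n _ _); have := key (-1); rewrite sqrrN expr1n => /(_ erefl).
by case: (ger0P (dot p f g)) => _; lra.
Qed.

Lemma autocov_geometric P : stochastic P ->
    (forall x, 0 < invariant_pmf P 0 x) -> is_invariant_pmf P (invariant_pmf P) ->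
    irreducible (nabla P) ->
  exists2 s : R, 0 < s < 1 & forall f, invariant_pmf P *m f = 0 ->
    forall k, `|dot (invariant_pmf P) f (P ^+ k *m f)| <=
      dot (invariant_pmf P) f f * s ^+ k.
Proof.
set p := invariant_pmf P => stP p0 pinv irrQ; have [_ _ pP] := pinv.
have [rho /andP[rho0 rho1] contr] := nabla_contraction stP p0 pinv irrQ.
have p0' x : 0 <= p 0 x by exact: ltW.
(* By AM-GM [s ^+ 2] dominates [rho], which avoids a square root. *)
pose s := (1 + rho) / 2.
have s0 : 0 < s by rewrite /s; lra.
have s1 : s < 1 by rewrite /s; lra.
have rho_s : rho <= s ^+ 2.
  rewrite -subr_ge0; have -> : s ^+ 2 - rho = ((1 - rho) / 2) ^+ 2 by rewrite /s; field.
  exact: sqr_ge0.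
exists s; first by rewrite s0.
move=> f pf k.
(* The zero mean is carried along because each use of [contr] requires it. *)
have [pk nk] : p *m (P ^+ k *m f) = 0 /\
    dot p (P ^+ k *m f) (P ^+ k *m f) <= (s ^+ 2) ^+ k * dot p f f.
  elim: k => [|k [IH1 IH2]]; first by rewrite !expr0 mul1mx mul1r.
  rewrite exprS -mulmxE -mulmxA mulmxA pP; split=> //.
  apply: le_trans (contr _ IH1) _; rewrite exprS -mulrA.
  apply: ler_pM => //; exact: dot_ge0.
have sk : 0 < s ^+ k by rewrite exprn_gt0.
(* With weight [s ^+ k] both terms are at most [s ^+ k * dot p f f]. *)
have := dot_le_weighted f (P ^+ k *m f) p0' sk.
rewrite exprAC expr2 in nk.
have : (s ^+ k)^-1 * dot p (P ^+ k *m f) (P ^+ k *m f) <= s ^+ k * dot p f f.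
  by rewrite mulrC ler_pdivrMr // mulrAC.
lra.
Qed.

Lemma dot_nonexpansive P p f : stochastic P -> (forall x, 0 <= p 0 x) ->
  p *m P = p -> dot p (P *m f) (P *m f) <= dot p f f.
Proof.
move=> stP p0 pP; rewrite -subr_ge0 dot_energy //; have [P0 _] := stP.
apply: sumr_ge0 => z _; rewrite mulr_ge0 //.
by apply: sumr_ge0 => y _; rewrite mulr_ge0 // sqr_ge0.
Qed.

Definition cos_sum P f (theta : R) n : 'cV[R]_d :=
  \sum_(k < n) cos (k%:R * theta) *: (P ^+ k *m f).

Definition sin_sum P f (theta : R) n : 'cV[R]_d :=
  \sum_(k < n) sin (k%:R * theta) *: (P ^+ k *m f).

(** This and the next lemma are, up to sign, the real and imaginary parts of
    [g_(n+1) = f + z^-1 P g_n]: split off [k = 0] and add angles. *)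
Lemma cos_sumS P f theta n : cos_sum P f theta n.+1 =
  f + (cos theta *: (P *m cos_sum P f theta n)
       - sin theta *: (P *m sin_sum P f theta n)).
Proof.
rewrite /cos_sum /sin_sum big_ord_recl /= mul0r cos0 scale1r expr0 mul1mx.
congr (_ + _); rewrite !mulmx_sumr !scaler_sumr -sumrB; apply: eq_bigr => k _.
rewrite /bump /= add1n -natr1 mulrDl mul1r cosD exprS -mulmxE -mulmxA scalerBl.
by rewrite -!scalemxAr !scalerA [cos theta * _]mulrC [sin theta * _]mulrC.
Qed.

Lemma sin_sumS P f theta n : sin_sum P f theta n.+1 =
  sin theta *: (P *m cos_sum P f theta n) + cos theta *: (P *m sin_sum P f theta n).
Proof.
rewrite /cos_sum /sin_sum big_ord_recl /= mul0r sin0 scale0r add0r.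
rewrite !mulmx_sumr !scaler_sumr -big_split; apply: eq_bigr => k _ /=.
rewrite /bump /= add1n -natr1 mulrDl mul1r sinD exprS -mulmxE -mulmxA scalerDl.
by rewrite -!scalemxAr !scalerA addrC [cos theta * _]mulrC [sin theta * _]mulrC.
Qed.

Definition spectrum_energy P p f theta n : R :=
  dot p (cos_sum P f theta n) (cos_sum P f theta n)
  + dot p (sin_sum P f theta n) (sin_sum P f theta n).

(* With [g n = cos_sum n - i sin_sum n = \sum_(k < n) z^-k P^k f] one has
   [g n.+1 - f = z^-1 P (g n)], so that [2 Re <f, g n.+1> - |f|^2] equals
   [|g n.+1|^2 - |P (g n)|^2], and [P] is a contraction. *)
Lemma spectrum_telescope P p f theta n : stochastic P ->
    (forall x, 0 <= p 0 x) -> p *m P = p ->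
  spectrum_energy P p f theta n.+1 - spectrum_energy P p f theta n <=
    2 * (\sum_(k < n.+1) dot p f (P ^+ k *m f) * cos (k%:R * theta)) - dot p f f.
Proof.
move=> stP p0 pP.
have -> : \sum_(k < n.+1) dot p f (P ^+ k *m f) * cos (k%:R * theta) =
    dot p f (cos_sum P f theta n.+1).
  rewrite /dot /cos_sum; under eq_bigr do rewrite mulr_suml.
  rewrite exchange_big; apply: eq_bigr => x _ /=.
  rewrite summxE !mulr_sumr; apply: eq_bigr => k _.
  by rewrite [in RHS]mxE; ring.
have := dot_nonexpansive (cos_sum P f theta n) stP p0 pP.
have := dot_nonexpansive (sin_sum P f theta n) stP p0 pP.
rewrite /spectrum_energy cos_sumS sin_sumS; set a := P *m cos_sum _ _ _ _; set b := P *m _.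
(* Rotating [(a, b)] by [theta] preserves the sum of the squared norms, and the terms in [f] agree
   on both sides. *)
suff : dot p a a + dot p b b + 2 * dot p f (f + (cos theta *: a - sin theta *: b))
    - dot p f f =
    dot p (f + (cos theta *: a - sin theta *: b)) (f + (cos theta *: a - sin theta *: b))
    + dot p (sin theta *: a + cos theta *: b) (sin theta *: a + cos theta *: b).
  by lra.
rewrite /dot mulr_sumr -!big_split -sumrB; apply: eq_bigr => x _ /=.
clearbody a b; rewrite !mxE; set u := a x 0; set v := b x 0; set w := f x 0.
have cs : sin theta ^+ 2 = 1 - cos theta ^+ 2.
  by rewrite -(cos2Dsin2 theta) addrC addKr.
have -> : p 0 x * ((w + (cos theta * u - sin theta * v)) *
      (w + (cos theta * u - sin theta * v))) +
    p 0 x * ((sin theta * u + cos theta * v) * (sin theta * u + cos theta * v)) =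
  p 0 x * (w ^+ 2 + 2 * w * (cos theta * u - sin theta * v)
    + (u ^+ 2 + v ^+ 2) * (cos theta ^+ 2 + sin theta ^+ 2)) by ring.
by rewrite cs; ring.
Qed.

(** If [l] were negative, [u] would eventually stay below [l / 2], so [t] would fall by at least
    [- l / 2] per step and become negative. *)
Lemma lim_ge0_of_telescope (t u : nat -> R) (l : R) : (forall n, 0 <= t n) ->
  (forall n, t n.+1 - t n <= u n) -> u n @[n --> \oo] --> l -> 0 <= l.
Proof.
move=> t0 tu ul; rewrite leNgt; apply/negP => l0.
have e0 : 0 < - l / 2 by lra.
have /cvgrPdist_lt/(_ _ e0)[N _ uN] := ul.
have drop m : t (N + m)%N <= t N - m%:R * (- l / 2).
  elim: m => [|m IHm]; first by rewrite addn0 mul0r subr0.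
  have := uN (N + m)%N (leq_addr _ _); rewrite /= ltr_norml => /andP[h1 _].
  have := tu (N + m)%N; rewrite addnS -natr1 mulrDl mul1r.
  move: IHm h1; set y := m%:R * _; lra.
have [m] : exists m : nat, t N / (- l / 2) < m%:R.
  by exists (Num.bound (t N / (- l / 2))); rewrite archi_boundP // divr_ge0 // ltW.
rewrite ltr_pdivrMr // => hm.
by have := drop m; have := t0 (N + m)%N; move: hm; set y := m%:R * _; lra.
Qed.

(** Domination by a geometric series; [phi] is later [cos] and [sin]. *)
Lemma power_spectrum_cvg P (phi : R -> R) f theta : stochastic P ->
    (forall x, 0 < invariant_pmf P 0 x) -> is_invariant_pmf P (invariant_pmf P) ->
    irreducible (nabla P) -> (forall x, `|phi x| <= 1) -> invariant_pmf P *m f = 0 ->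
  cvgn (series (fun k => dot (invariant_pmf P) f (P ^+ k *m f) * phi (k%:R * theta))).
Proof.
move=> stP p0 pinv irrQ phi1 pf.
have [s /andP[s0 s1] bound] := autocov_geometric stP p0 pinv irrQ.
set p := invariant_pmf P in bound *.
apply: normed_cvg.
apply: series_le_cvg (is_cvg_geometric_series (a := dot p f f) (z := s) _).
- by move=> k; exact: normr_ge0.
- move=> k; rewrite /= mulr_ge0 ?exprn_ge0 ?(ltW s0) //.
  by apply: dot_ge0 => x; exact: ltW.
- move=> k; rewrite /= normrM; apply: le_trans (bound f pf k).
  by rewrite ler_piMr.
- by rewrite gtr0_norm.
Qed.

(** This is nonnegativity of the spectral density [r_0 + 2 \sum_(k >= 1) r_k cos (k theta)]; the
    series here includes [k = 0], which puts one [r_0] on the left. *)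
Lemma power_spectrum_ge0 P f theta : stochastic P ->
    (forall x, 0 < invariant_pmf P 0 x) -> is_invariant_pmf P (invariant_pmf P) ->
    irreducible (nabla P) -> invariant_pmf P *m f = 0 ->
  dot (invariant_pmf P) f f <=
  2 * limn (series (fun k => dot (invariant_pmf P) f (P ^+ k *m f)
                             * cos (k%:R * theta))).
Proof.
move=> stP p0 pinv irrQ pf; have [p0' _ pP] := pinv.
have cvgS := power_spectrum_cvg (theta := theta) stP p0 pinv irrQ (@cos_max R) pf.
rewrite -subr_ge0.
apply: (lim_ge0_of_telescope _ (fun n => spectrum_telescope f theta n stP p0' pP)).
  by move=> n; rewrite addr_ge0 // dot_ge0.
apply: cvgB; last exact: cvg_cst.
apply: cvgM; first exact: cvg_cst.
(* The increment from [n] to [n.+1] is bounded through a partial sum of [n.+1] terms, hence the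
   shift. *)
under eq_fun do rewrite -(big_mkord predT
  (fun k => dot _ f (P ^+ k *m f) * cos (k%:R * theta))).
by rewrite -(cvg_shiftS (series _)) in cvgS.
Qed.

End PowerSpectrum.

(** * Exponential tilting of a transition matrix and its derivative *)

Section Tilting.
Context {R : realType} {d : nat}.
Variable P0 : 'M[R]_d.
Hypothesis P0_stochastic : stochastic P0.
Implicit Types h : 'M[R]_d.

Definition partition_fun h x : R := \sum_y P0 x y * expR (h x y).

Lemma partition_fun_gt0 h x : 0 < partition_fun h x.
Proof.
have [P0_ge0 P01] := P0_stochastic.
have t0 y : 0 <= P0 x y * expR (h x y) by rewrite mulr_ge0 // expR_ge0.
rewrite lt_neqAle sumr_ge0 // andbT eq_sym; apply/eqP => sum0.
have := P01 x; rewrite big1 => [/eqP|y _]; first by rewrite eq_sym oner_eq0.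
have /eqP := psumr_eq0P (fun y _ => t0 y) sum0 (i := y) isT.
by rewrite mulf_eq0 (gt_eqF (expR_gt0 _)) orbF => /eqP.
Qed.

Lemma tiltE h x y : tilt P0 h x y = P0 x y * expR (h x y) / partition_fun h x.
Proof. by rewrite mxE expRD expRN lnK ?posrE ?partition_fun_gt0 // mulrA. Qed.

Lemma tilt_stochastic h : stochastic (tilt P0 h).
Proof.
have [P0_ge0 _] := P0_stochastic; split=> [x y|x].
  by rewrite mxE mulr_ge0 // expR_ge0.
under eq_bigr do rewrite tiltE.
by rewrite -mulr_suml -/(partition_fun h x) divff // gt_eqF ?partition_fun_gt0.
Qed.

Lemma tilt_gt0 h x y : (0 < tilt P0 h x y) = (0 < P0 x y).
Proof. by rewrite mxE pmulr_lgt0 // expR_gt0. Qed.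

Lemma tilt_irreducible h : irreducible P0 -> irreducible (tilt P0 h).
Proof.
apply: irreducible_support => [||x y]; last by rewrite tilt_gt0.
- by case: P0_stochastic.
- by case: (tilt_stochastic h).
Qed.

(** Tilting multiplies entries by positive factors, so the supports of [P0] and [nabla P0] persist.
    [x0] witnesses a nonempty state space, without which there is no pmf. *)
Lemma tilt_nabla_irreducible h (x0 : 'I_d) : irreducible P0 ->
  irreducible (nabla P0) -> irreducible (nabla (tilt P0 h)).
Proof.
move=> irr0 irrQ0; have irrP := tilt_irreducible h irr0.
have stP := tilt_stochastic h.
have pos0 x := invariant_pmf_gt0 x P0_stochastic irr0 (invariant_pmfP x0 P0_stochastic).
have pos x := invariant_pmf_gt0 x stP irrP (invariant_pmfP x0 stP).
have [ge0 _] := P0_stochastic; have [ge _] := stP.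
apply: irreducible_support irrQ0 => [x y|x y|x y].
- by apply: nabla_ge0 => // z; exact: ltW.
- by apply: nabla_ge0 => // z; exact: ltW.
- move=> /(nabla_gt0P _ _ pos0 ge0)[z zP]; apply/(nabla_gt0P _ _ pos ge).
  by exists z; rewrite !tilt_gt0.
Qed.

(** The derivative of the log-partition function is the mean of [dh x] under the tilted row, so the
    entry gets multiplied by [dh x y] centered under that row. *)
Lemma is_derive_tilt (h : R -> 'M[R]_d) (dh : 'M[R]_d) (zeta : R) x y :
    (forall x y, is_derive zeta 1 (fun s => h s x y : R) (dh x y)) ->
  is_derive zeta 1 (fun s => tilt P0 (h s) x y : R)
    (tilt P0 (h zeta) x y
     * (dh x y - \sum_z tilt P0 (h zeta) x z * dh x z)).
Proof.
move=> dhP.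
have dexp z : is_derive zeta 1 (fun s => P0 x z * expR (h s x z))
    (P0 x z * (expR (h zeta x z) * dh x z)).
  by apply: is_deriveZ; apply: is_derive1_comp.
have dpart : is_derive zeta 1 (fun s => partition_fun (h s) x)
    (\sum_z P0 x z * (expR (h zeta x z) * dh x z)).
  rewrite (_ : (fun s => _) = \sum_z (fun s => P0 x z * expR (h s x z))).
    exact: is_derive_sum.
  by apply/funext => s; rewrite fct_sumE.
have dln : is_derive zeta 1 (fun s => ln (partition_fun (h s) x))
   ((partition_fun (h zeta) x)^-1 * \sum_z P0 x z * (expR (h zeta x z) * dh x z)).
  by apply: (is_derive1_comp (f := @ln R)); exact: is_derive1_ln (partition_fun_gt0 _ _).
have darg := is_deriveB (dhP x y) dln.
have dtilt : is_derive zeta 1 (fun s => P0 x y * expR (h s x y - ln (partition_fun (h s) x)))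
  (P0 x y * (expR (h zeta x y - ln (partition_fun (h zeta) x)) *
   (dh x y - (partition_fun (h zeta) x)^-1 * \sum_z P0 x z * (expR (h zeta x z) * dh x z)))).
  by apply: is_deriveZ; apply: (is_derive1_comp (f := expR)).
rewrite (_ : (fun s => _) = (fun s => P0 x y * expR (h s x y - ln (partition_fun (h s) x)))).
  apply: is_derive_eq dtilt _; rewrite [in RHS]mxE -mulrA; congr (_ * (_ * (_ - _))).
  rewrite mulr_sumr; apply: eq_bigr => z _; rewrite tiltE; ring.
by apply/funext => s; rewrite mxE.
Qed.

End Tilting.

(** * Invertibility behind [Znabla] and Poisson's equation *)

Section FundamentalMatrix.
Context {R : realType} {d : nat}.
Variable P : 'M[R]_d.
Hypothesis P_stochastic : stochastic P.
Hypothesis pi_gt0 : forall x, 0 < invariant_pmf P 0 x.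
Hypothesis piP : is_invariant_pmf P (invariant_pmf P).
Hypothesis nabla_irr : irreducible (nabla P).
Local Notation p := (invariant_pmf P).

(** Adjunction exchanges two properties: invariance of [p] gives the row sums of [adjoint P], and
    the row sums of [P] give invariance under [adjoint P], used next. *)
Lemma adjoint_mul1 : adjoint P *m const_mx 1 = const_mx 1 :> 'cV[R]_d.
Proof.
have [_ _ pP] := piP; apply/colP => x; rewrite [LHS]mxE [RHS]mxE.
have sum_pP : \sum_y p 0 y * P y x = p 0 x by rewrite -[in RHS]pP mxE.
under eq_bigr do rewrite !mxE mulr1 mulrAC.
by rewrite -mulr_suml sum_pP divff // gt_eqF // pi_gt0.
Qed.

Lemma invariant_pmf_nabla : p *m nabla P = p.
Proof.
have [_ P1] := P_stochastic; have [_ _ pP] := piP.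
rewrite /nabla mulmxA -[RHS]pP; congr (_ *m _); apply/rowP => x.
rewrite mxE -[RHS]mulr1 -(P1 x) mulr_sumr; apply: eq_bigr => y _.
by rewrite mxE mulrA mulrCA divff ?mulr1 // gt_eqF // pi_gt0.
Qed.

Lemma nabla_mul1 : nabla P *m const_mx 1 = const_mx 1 :> 'cV[R]_d.
Proof. by rewrite /nabla -mulmxA stochastic_mul1 // adjoint_mul1. Qed.

Local Notation M := (1%:M - nabla P + (const_mx 1 : 'cV[R]_d) *m p).

Lemma pmf_mul1 : p *m const_mx 1 = 1%:M :> 'M[R]_1.
Proof.
have [_ p1 _] := piP; apply/matrixP => i j; rewrite !ord1 [LHS]mxE [RHS]mxE eqxx -[RHS]p1.
by apply: eq_bigr => x _; rewrite mxE mulr1.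
Qed.

Lemma pmf_mul_Znabla_inv : p *m M = p.
Proof.
by rewrite mulmxDr mulmxBr mulmx1 invariant_pmf_nabla subrr add0r mulmxA
           pmf_mul1 mul1mx.
Qed.

(** A kernel vector [f] has mean zero because [p *m M = p], hence is fixed by [nabla P]; then [P]
    preserves its norm, and the contraction forces [f = 0]. *)
Lemma Znabla_unit : M \in unitmx.
Proof.
rewrite -unitmx_tr -row_free_unit; apply: inj_row_free => v vM.
suff: v^T = 0 by move=> /(congr1 trmx); rewrite trmxK trmx0.
have Mf : M *m v^T = 0 by rewrite -[LHS]trmxK trmx_mul trmxK vM trmx0.
have pf : p *m v^T = 0 by rewrite -pmf_mul_Znabla_inv -mulmxA Mf mulmx0.
have Qf : nabla P *m v^T = v^T.
  move: Mf; rewrite mulmxDl mulmxBl mul1mx -mulmxA pf mulmx0 addr0 => /eqP.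
  by rewrite subr_eq0 => /eqP.
have [rho /andP[rho0 rho1] contr] := nabla_contraction P_stochastic pi_gt0 piP nabla_irr.
apply: (dot_eq0 pi_gt0); have := contr _ pf.
rewrite dot_adjoint ?mulmxA => [|x]; last by rewrite gt_eqF.
rewrite -/(nabla P) Qf; have := dot_ge0 v^T (fun x => ltW (pi_gt0 x)).
nra.
Qed.

(** Apply [M *m Znabla P = 1] to [u]; since [p *m Znabla P = p], the rank-one term reduces to the
    mean of [u]. *)
Lemma nabla_poisson (u : 'cV[R]_d) :
  Znabla P *m u - nabla P *m (Znabla P *m u) = u - const_mx 1 *m (p *m u).
Proof.
have MZ : M *m Znabla P = 1%:M by rewrite mulmxV ?Znabla_unit.
have pZ : p *m Znabla P = p by rewrite -{1}pmf_mul_Znabla_inv -mulmxA MZ mulmx1.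
have := congr1 (fun A => A *m u) MZ; rewrite /= mul1mx -mulmxA.
rewrite mulmxDl mulmxBl mul1mx -[X in _ + X]mulmxA [p *m _]mulmxA pZ => {3}<-.
by rewrite addrK.
Qed.

End FundamentalMatrix.

(** * Complex series on the unit circle by real and imaginary parts *)

Section ComplexSeries.
Context {R : realType}.

Lemma cvg_complex (u v : nat -> R) (a b : R) :
    u n @[n --> \oo] --> a -> v n @[n --> \oo] --> b ->
  (u n +i* v n : R[i]^o) @[n --> \oo] --> (a +i* b : R[i]^o).
Proof.
(* A positive radius in [R[i]] is real, so [e' = 0]; errors below [e / 2] in both parts give a
   modulus below [e]. *)
move=> ua vb; apply/cvgrPdist_lt => -[e e'] /=; rewrite ltcE /= => /andP[/eqP -> e0].
have e20 : 0 < e / 2 by rewrite divr_gt0.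
move/cvgrPdist_lt/(_ _ e20): ua => ua; move/cvgrPdist_lt/(_ _ e20): vb => vb.
near=> n.
have hu : `|a - u n| < e / 2 by near: n.
have hv : `|b - v n| < e / 2 by near: n.
rewrite normc_def ltcE /= eqxx /=.
have e_ge0 : 0 <= e by exact: ltW.
rewrite -[ltRHS]ger0_norm // -sqrtr_sqr ltr_sqrt ?exprn_gt0 //.
move: hu hv; rewrite -(ltr_sqr (y := e / 2)) ?nnegrE ?normr_ge0 ?(ltW e20) //.
rewrite -[in X in _ -> X -> _](ltr_sqr (y := e / 2)) ?nnegrE ?normr_ge0 ?(ltW e20) //.
rewrite !real_normK ?num_real // => hu hv.
have : 0 < e ^+ 2 by rewrite exprn_gt0.
lra.
Unshelve. all: by end_near.
Qed.

Lemma expi_inv (theta : R) : (expi theta)^-1 = expi (- theta).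
Proof.
have expi_neq0 : expi theta != 0.
  apply/eqP => /eqP; rewrite eq_complex /= => /andP[/eqP c0 /eqP s0].
  have := cos2Dsin2 theta; rewrite c0 s0 !expr0n addr0 => /eqP.
  by rewrite eq_sym oner_eq0.
apply: (mulfI expi_neq0); rewrite mulfV //; apply/eqP.
rewrite eq_complex /expi /= cosN sinN; apply/andP; split; apply/eqP.
  by rewrite mulrN opprK -!expr2 cos2Dsin2.
by ring.
Qed.

Lemma expi_exp (theta : R) k : expi theta ^+ k = expi (k%:R * theta).
Proof.
elim: k => [|k IHk]; first by rewrite expr0 mul0r /expi cos0 sin0.
rewrite exprSr IHk -natr1 mulrDl mul1r /expi cosD sinD.
by apply/eqP; rewrite eq_complex /= !eqxx /= addrC eqxx.
Qed.

Lemma series_expi (r : nat -> R) (theta : R) n :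
  series (fun k => (r k)%:C * expi theta ^- k : R[i]^o) n =
  series (fun k => r k * cos (k%:R * theta)) n
  +i* - series (fun k => r k * sin (k%:R * theta)) n.
Proof.
rewrite /series /=; elim: n => [|n IHn]; first by rewrite !big_nil oppr0.
rewrite !big_nat_recr //= IHn -exprVn expi_inv expi_exp mulrN /expi cosN sinN.
by apply/eqP; rewrite eq_complex /=; apply/andP; split; apply/eqP; ring.
Qed.

Lemma cvg_series_expi (r : nat -> R) (theta : R) :
    cvgn (series (fun k => r k * cos (k%:R * theta))) ->
    cvgn (series (fun k => r k * sin (k%:R * theta))) ->
  series (fun k => (r k)%:C * expi theta ^- k : R[i]^o) n @[n --> \oo] -->
  (limn (series (fun k => r k * cos (k%:R * theta)))
   +i* - limn (series (fun k => r k * sin (k%:R * theta))) : R[i]^o).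
Proof.
move=> cvgc cvgs; under eq_fun do rewrite series_expi.
by apply: cvg_complex => //; exact: cvgN.
Qed.

End ComplexSeries.

(** * Transfer coefficients as autocovariances *)

Section Linearization.
Context {R : realType} {d : nat}.
Variables (P0 : 'M[R]_d) (U : 'I_d -> R) (x0 : 'I_d).
Variables (h P : R -> 'M[R]_d) (zeta : R).
Hypothesis P0_stochastic : stochastic P0.
Hypothesis P0_irreducible : irreducible P0.
Hypothesis P0_nabla_irreducible : irreducible (nabla P0).
Hypothesis hP_spd : spd_solution P0 U x0 h P.
Local Notation p := (invariant_pmf (P zeta)).

Definition centered : 'cV[R]_d := \col_i (U i - pmf_mean p U).

Lemma spd_tilt : P zeta = tilt P0 (h zeta).
Proof. by case: hP_spd => _ _ _ _ ->. Qed.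

Lemma spd_stochastic : stochastic (P zeta).
Proof. by rewrite spd_tilt; exact: tilt_stochastic. Qed.

Lemma spd_nabla_irreducible : irreducible (nabla (P zeta)).
Proof. by rewrite spd_tilt; exact: tilt_nabla_irreducible. Qed.

Lemma spd_invariant_pmfP : is_invariant_pmf (P zeta) p.
Proof. exact: invariant_pmfP x0 spd_stochastic. Qed.

Lemma spd_invariant_pmf_gt0 x : 0 < p 0 x.
Proof.
apply: invariant_pmf_gt0 spd_stochastic _ spd_invariant_pmfP.
by rewrite spd_tilt; exact: tilt_irreducible.
Qed.

Lemma pmf_mul_centered : p *m centered = 0.
Proof.
have [_ p1 _] := spd_invariant_pmfP.
apply/matrixP => i j; rewrite !ord1 [LHS]mxE [RHS]mxE.
under eq_bigr do rewrite mxE mulrBr.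
by rewrite sumrB -mulr_suml p1 mul1r subrr.
Qed.

(** Since [calH] depends only on its second argument, its conditional mean in row [x] is [P H] at
    [x]. *)
Lemma derive_spd x y : derive1 (fun s => P s x y : R) zeta =
  P zeta x y * (Hcirc U x0 (P zeta) y - \sum_z P zeta x z * Hcirc U x0 (P zeta) z).
Proof.
have [_ dh _ h' Ptilt] := hP_spd.
have dhP u v : is_derive zeta 1 (fun s => h s u v : R) (calH U x0 (P zeta) u v).
  by rewrite -h' derive1E; exact: derivableP.
rewrite (_ : (fun s => P s x y) = (fun s => tilt P0 (h s) x y)); last first.
  by apply/funext => s; rewrite Ptilt.
rewrite derive1E (derive_val (is_derive := is_derive_tilt P0_stochastic x y dhP)) -Ptilt mxE.
by congr (_ * (_ - _)); apply: eq_bigr => z _; rewrite mxE.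
Qed.

Lemma lin_BE i : lin_B P zeta i 0 = p 0 i * centered i 0.
Proof.
have [_ _ pP] := spd_invariant_pmfP.
pose H : 'cV[R]_d := \col_x Hcirc U x0 (P zeta) x.
pose u : 'cV[R]_d := \col_x U x.
have sum_pP : \sum_x p 0 x * P zeta x i = p 0 i by rewrite -[in RHS]pP mxE.
(* Averaging the [P H] term against [p] brings in the adjoint, as
   [p(x) P(x, i) = p(i) adjoint(i, x)]; the [H i] term uses [p P = p]. *)
have -> : lin_B P zeta i 0 = p 0 i * (H i 0 - (nabla (P zeta) *m H) i 0).
  rewrite mxE mulrBr /nabla -mulmxA [in RHS]mxE -sum_pP mulr_suml.
  rewrite [(adjoint _ *m _) i 0]mxE mulr_sumr -sumrB; apply: eq_bigr => x _.
  rewrite derive_spd mulrBr mulrBr mulrA; congr (_ - _).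
  rewrite sum_pP [adjoint _ _ _]mxE [in RHS]mxE.
  have -> : \sum_z P zeta x z * H z 0 = \sum_z P zeta x z * Hcirc U x0 (P zeta) z.
    by apply: eq_bigr => z _; rewrite mxE.
  by field; rewrite gt_eqF // spd_invariant_pmf_gt0.
congr (_ * _); set w := Znabla (P zeta) *m u.
(* The normalization at [x0] only subtracts a constant, which [I - nabla P] annihilates. *)
have HE : H = w - (w x0 0) *: const_mx 1.
  have HE0 x : H x 0 = w x 0 - w x0 0.
    rewrite !mxE /Hcirc -sumrB; apply: eq_bigr => y _.
    by rewrite !mxE mulrBl.
  by apply/colP => x; rewrite HE0; clearbody w; rewrite !mxE mulr1.
have -> : H i 0 - (nabla (P zeta) *m H) i 0 = (H - nabla (P zeta) *m H) i 0.
  by rewrite [RHS]mxE [X in _ = _ + X]mxE.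
have nabla1 := nabla_mul1 spd_stochastic spd_invariant_pmf_gt0 spd_invariant_pmfP.
rewrite HE mulmxBr -scalemxAr nabla1 opprB addrA subrK.
rewrite nabla_poisson //; last 4 first.
- exact: spd_stochastic.
- exact: spd_invariant_pmf_gt0.
- exact: spd_invariant_pmfP.
- exact: spd_nabla_irreducible.
have mean : p *m u = (pmf_mean p U)%:M :> 'M[R]_1.
  apply/matrixP => a b; rewrite !ord1 [LHS]mxE [RHS]mxE eqxx.
  by apply: eq_bigr => x _; rewrite mxE.
by rewrite mean mul_mx_scalar !mxE mulr1.
Qed.

(** Transposition makes [A^k] act as [P^k] on [centered], and the weight [p 0 i] from [lin_BE] turns
    the product with [B] into an inner product of L2(p). *)
Lemma transfer_coefE k :
  (lin_C U P zeta *m lin_A P zeta ^+ k *m lin_B P zeta) 0 0 =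
  dot p centered (P zeta ^+ k *m centered).
Proof.
have -> : lin_A P zeta ^+ k = (P zeta ^+ k)^T.
  elim: k => [|k IHk]; first by rewrite !expr0 trmx1.
  by rewrite exprS exprSr IHk -!mulmxE trmx_mul.
have -> : lin_C U P zeta = centered^T by apply/rowP => i; rewrite !mxE.
rewrite -trmx_mul mxE; apply: eq_bigr => i _; rewrite lin_BE [_^T _ _]mxE.
ring.
Qed.

Lemma dot_centered : dot p centered centered = pmf_variance p U.
Proof. by apply: eq_bigr => x _; rewrite !mxE expr2. Qed.

End Linearization.

Theorem theorem2p3 (R : realType) (d : nat) (U : 'I_d -> R) (x0 : 'I_d)
    (P0 : 'M[R]_d) (h P : R -> 'M[R]_d)
    (U_ge0 : forall x, 0 <= U x)
    (P0_stochastic : stochastic P0)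
    (P0_irreducible : irreducible P0)
    (P0_aperiodic : aperiodic P0)
    (P0_nabla_irreducible : irreducible (nabla P0))
    (hP_spd : spd_solution P0 U x0 h P) :
  forall zeta theta : R,
    [/\ transfer_cvg U P zeta (expi theta),
        transfer_cvg U P zeta (expi (- theta))
      & transfer U P zeta (expi theta) + transfer U P zeta (expi (- theta))
        >= (pmf_variance (invariant_pmf (P zeta)) U)%:C].
Proof.
move=> zeta theta; set p := invariant_pmf (P zeta).
have stP := spd_stochastic zeta P0_stochastic hP_spd.
have pinv := spd_invariant_pmfP zeta P0_stochastic hP_spd.
have p0 := spd_invariant_pmf_gt0 zeta P0_stochastic P0_irreducible hP_spd.
have irrQ := spd_nabla_irreducible zeta P0_stochastic P0_irreducible
  P0_nabla_irreducible hP_spd.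
have pf := pmf_mul_centered zeta P0_stochastic hP_spd.
set f := centered U P zeta in pf.
pose r k := dot p f (P zeta ^+ k *m f).
have termE z : transfer_term U P zeta z = (fun k => (r k)%:C * z ^- k : R[i]^o).
  apply/funext => k; rewrite /transfer_term.
  by rewrite (transfer_coefE zeta P0_stochastic P0_irreducible
    P0_nabla_irreducible hP_spd).
have cvgc t := power_spectrum_cvg (theta := t) stP p0 pinv irrQ (@cos_max R) pf.
have cvgs t := power_spectrum_cvg (theta := t) stP p0 pinv irrQ (@sin_max R) pf.
have lim t := cvg_series_expi (cvgc t) (cvgs t).
have transferE t : transfer U P zeta (expi t) =
    limn (series (fun k => r k * cos (k%:R * t)))
    +i* - limn (series (fun k => r k * sin (k%:R * t))).
  by rewrite /transfer termE; apply: cvg_lim (lim t); exact: norm_hausdorff.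
(* Convergence accompanies the bound because [limn] of a divergent series is only a default
   value. *)
split; try by rewrite /transfer_cvg termE; apply: cvgP (lim _).
rewrite !transferE.
(* The cosine sums are even in [theta] and double, the sine sums are odd and cancel; both sides are
   then real and [lecE] leaves a real inequality. *)
have -> : (fun k => r k * cos (k%:R * - theta)) = (fun k => r k * cos (k%:R * theta)).
  by apply/funext => k; rewrite mulrN cosN.
have -> : (fun k => r k * sin (k%:R * - theta)) = - (fun k => r k * sin (k%:R * theta)).
  by apply/funext => k; rewrite mulrN sinN mulrN.
rewrite lim_seriesN // lecE /= opprK addNr eqxx /= -mulr2n -mulr_natl.
rewrite -(dot_centered U P zeta); exact: power_spectrum_ge0.
Qed.
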